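(* For every integer $n\ge 0$, \[A_{3}(n)=\tfrac{1}{3}\,\sigma(3n+2).\] Equivalently, if $3n+2=\prod_{i=1}^{s}p_{i}^{\alpha_i}$ is the prime factorization of $3n+2$, then \[A_{3}(n)=\frac{1}{3}\prod_{i=1}^{s}\frac{p_{i}^{\alpha_{i}+1}-1}{p_i-1}.\]
   Context: A partition $\lambda$ of a nonnegative integer is called a $3$-core if none of its hook lengths is divisible by $3$. $A_3(n)$ denotes the number of partition pairs of $n$ with $3$-cores, i.e. the number of ordered pairs $(\lambda_1,\lambda_2)$ of partitions, each a $3$-core, whose sizes sum to $n$; equivalently $\sum_{n\ge0}A_3(n)q^n=\frac{(q^3;q^3)_\infty^{6}}{(q;q)_\infty^{2}}$, where $(a;q)_\infty=\prod_{k\ge0}(1-aq^k)$. $\sigma(m)$ denotes the sum of the positive divisors of $m$. *)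

(* Defs.v *)
From mathcomp Require Import all_boot all_order all_algebra.
Set Implicit Arguments. Unset Strict Implicit. Unset Printing Implicit Defensive.
Import GRing.Theory Num.Theory.

Definition is_partition (m : nat) (la : seq nat) : bool :=
  [&& sorted geq la, all (fun x => 0 < x) la & sumn la == m].

Definition conj_part (la : seq nat) (j : nat) : nat := count (fun x => j < x) la.

(* hook length of the cell (i, j) (0-indexed row i, column j):
   arm + leg + 1 = (la_i - j - 1) + (la'_j - i - 1) + 1 *)
Definition hook (la : seq nat) (i j : nat) : nat :=
  (nth 0 la i - j) + (conj_part la j - i) - 1.

Definition three_core (la : seq nat) : bool :=
  all (fun i => all (fun j => ~~ (3 %| hook la i j)) (iota 0 (nth 0 la i)))
      (iota 0 (size la)).

(* candidate sequences: all sequences of length <= m with entries <= m;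
   every partition of m is among them *)
Definition candidates (m : nat) : seq (seq nat) :=
  flatten [seq [seq map val (tval t) | t : k.-tuple 'I_m.+1] | k <- iota 0 m.+1].

Definition partitions_of (m : nat) : seq (seq nat) :=
  undup (filter (is_partition m) (candidates m)).

Definition c3 (m : nat) : nat := count three_core (partitions_of m).

(* A_3(n): number of ordered pairs (la1, la2) of 3-cores with |la1|+|la2| = n *)
Definition A3 (n : nat) : nat := \sum_(k < n.+1) c3 k * c3 (n - k).

Definition sigma (m : nat) : nat := \sum_(d <- divisors m) d.

(* Main.v *)
(* The beta-set (first-column hook lengths) of a 3-core is
   {1, 4, ..., 3a-2} U {2, 5, ..., 3b-1}, so 3-cores of m correspond to pairs
   (a, b) of naturals with a^2 - ab + b^2 + b = m; these are one sixth of the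
   Eisenstein integers of norm 3m+1. Comparing the recursion
   r(pN) + chi(p) r(N/p) = (1 + chi(p)) r(N) for norms and for divisor sums gives
   c3(m) = sum_{d | 3m+1} chi(d), chi being the character mod 3. The convolution
   of these sums is a sum of chi(a) chi(b) = [3 | a-b] - [3 | a+b] over the
   positive solutions of ax + by = 3n+2, where the substitutions
   ax + by = (a-b)x + b(x+y) cancel all but diagonal terms (Liouville). *)
Require Import Defs.
From mathcomp Require Import all_boot all_order all_algebra.
From mathcomp Require Import fingroup pgroup finfield.
From mathcomp Require Import zify ring.
Import GRing.Theory Num.Theory.

(** * Quadruples and divisors *)

Lemma count_bij (T U : eqType) (s : seq T) (t : seq U) (P : pred T) (Q : pred U)
    (f : T -> U) (g : U -> T) :
  uniq s -> uniq t ->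
  (forall x, x \in s -> P x -> [/\ f x \in t, Q (f x) & g (f x) = x]) ->
  (forall y, y \in t -> Q y -> [/\ g y \in s, P (g y) & f (g y) = y]) ->
  count P s = count Q t.
Proof.
move=> us ut fP gP; rewrite -!size_filter -(size_map f).
apply/perm_size/uniq_perm; rewrite ?filter_uniq //.
  rewrite map_inj_in_uniq ?filter_uniq // => x y.
  rewrite !mem_filter => /andP[Px xs] /andP[Py ys] E.
  by have [_ _ <-] := fP x xs Px; have [_ _ <-] := fP y ys Py; rewrite E.
move=> y; rewrite mem_filter; apply/mapP/andP => [[x]|[Qy yt]].
  by rewrite mem_filter => /andP[Px xs] ->; have [] := fP x xs Px.
by have [gs Pg fg] := gP y yt Qy; exists (g y); rewrite ?mem_filter ?Pg.
Qed.

Lemma count_split (T : Type) (P Q : pred T) (s : seq T) :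
  count P s = count (fun x => P x && Q x) s + count (fun x => P x && ~~ Q x) s.
Proof. by elim: s => //= x s ->; case: (P x); case: (Q x) => /=; lia. Qed.

Lemma sum_count (T : Type) (P : pred T) (s : seq T) :
  (\sum_(x <- s) (P x)%:R = (count P s)%:Z)%R.
Proof. by elim: s => [|x s IH] /=; rewrite ?big_nil // big_cons IH; case: (P x). Qed.

Definition chi3 (n : nat) : int := ((n %% 3 == 1)%N%:R - (n %% 3 == 2)%N%:R)%R.

Definition chi3_sum (n : nat) : int := (\sum_(d <- divisors n) chi3 d)%R.

Lemma mem_divisors n d : 0 < n -> (d \in divisors n) = (d %| n).
Proof. by move=> n0; rewrite dvdn_divisors. Qed.

Definition cofactors (n : nat) : seq (nat * nat) :=
  [seq (d, n %/ d) | d <- divisors n].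

Lemma cofactors_uniq n : uniq (cofactors n).
Proof. by rewrite map_inj_uniq ?divisors_uniq // => d e []. Qed.

Lemma mem_cofactors n d e : 0 < n -> ((d, e) \in cofactors n) = (d * e == n).
Proof.
move=> n0; apply/mapP/eqP => [[c]|E].
  by rewrite mem_divisors // => cn [-> ->]; rewrite mulnC divnK.
exists d; first by rewrite mem_divisors // -E dvdn_mulr.
by rewrite -E mulKn //; move: n0; rewrite -E muln_gt0 => /andP[].
Qed.

Lemma sum_cofactors (R : nmodType) n (F : nat -> nat -> R) : 0 < n ->
  (\sum_(d <- divisors n) F d (n %/ d)%N = \sum_(d <- divisors n) F (n %/ d)%N d)%R.
Proof.
move=> n0.
have -> : (\sum_(d <- divisors n) F d (n %/ d)%N
    = \sum_(u <- cofactors n) F u.1 u.2)%R by rewrite big_map.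
have -> : (\sum_(d <- divisors n) F (n %/ d)%N d
    = \sum_(u <- [seq (u.2, u.1) | u <- cofactors n]) F u.1 u.2)%R.
  by rewrite !big_map.
apply/perm_big/uniq_perm; rewrite ?cofactors_uniq //.
  by rewrite map_inj_uniq ?cofactors_uniq // => -[a b] [c d] /= [-> ->].
case=> d e; rewrite mem_cofactors //; apply/eqP/mapP => [E|[[a b]]].
  by exists (e, d) => //; rewrite mem_cofactors // mulnC; apply/eqP.
by rewrite mem_cofactors // mulnC => /eqP E [-> ->].
Qed.

(** The positive solutions of [a x + b y = n], stored as [((a, x), (b, y))] and grouped by
    [k = a x], so that sums over them become convolutions. *)
Definition quads (n : nat) : seq ((nat * nat) * (nat * nat)) :=
  [seq uv | k <- iota 1 n.-1,
            uv <- [seq (u, v) | u <- cofactors k, v <- cofactors (n - k)]].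

Lemma mem_quads n a x b y :
  (((a, x), (b, y)) \in quads n)
  = [&& 0 < a, 0 < x, 0 < b, 0 < y & a * x + b * y == n].
Proof.
apply/allpairsPdep/idP => [[k [uv [kn /allpairsP[[u v] /= [uk vk ->]] [E1 E2]]]]|].
  move: uk vk; rewrite mem_iota in kn; rewrite -{}E1 -{}E2.
  rewrite !mem_cofactors; [|lia|lia] => /eqP E1 /eqP E2.
  by move: kn E1 E2; case: a; case: b; case: x; case: y; lia.
move=> /and5P[a0 x0 b0 y0 /eqP E].
have ax0 : 0 < a * x by rewrite muln_gt0 a0.
have by0 : 0 < b * y by rewrite muln_gt0 b0.
exists (a * x), ((a, x), (b, y)); split=> //; first by rewrite mem_iota; lia.
apply/allpairsP; exists ((a, x), (b, y)) => /=.
by split=> //; rewrite mem_cofactors //; lia.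
Qed.

Lemma quads_uniq n : uniq (quads n).
Proof.
apply: allpairs_uniq_dep; first exact: iota_uniq.
  by move=> k _; apply: allpairs_uniq => [||[u v] [w z] _ _]; rewrite ?cofactors_uniq.
move=> /= p q /allpairsPdep[k [uv [kn kuv ->]]] /allpairsPdep[k' [uv' [kn' kuv' ->]]].
move=> /= E; subst uv'; suff -> : k = k' by [].
move: kuv kuv' => /allpairsP[[[a x] [b y]] /= [uk vk ->]].
move=> /allpairsP[[[c z] [d t]] /= [uk' vk' [? ? ? ?]]].
subst; move: kn kn' uk uk'; rewrite !mem_iota => kn kn'.
by rewrite !mem_cofactors; [move=> /eqP -> /eqP -> | lia..].
Qed.

Lemma sum_quads (n : nat) (F G : nat -> int) :
  (\sum_(q <- quads n) F q.1.1 * G q.2.1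
   = \sum_(1 <= k < n) (\sum_(d <- divisors k) F d)
                       * (\sum_(d <- divisors (n - k)%N) G d))%R.
Proof.
rewrite /quads big_allpairs_dep /index_iota subn1.
apply: eq_bigr => k _; rewrite big_allpairs /= big_map mulr_suml.
by apply: eq_bigr => d _; rewrite big_map mulr_sumr.
Qed.

(** When 3 divides both [a] and [b], the two brackets are both 1 and cancel. *)
Lemma chi3_mul a b :
  (chi3 a * chi3 b = (a %% 3 == b %% 3)%N%:R - (3 %| a + b)%N%:R)%R.
Proof.
rewrite /chi3 /dvdn -modnDm; have := ltn_pmod a (isT : 0 < 3); have := ltn_pmod b (isT : 0 < 3).
by case: (a %% 3) => [|[|[|]]] //; case: (b %% 3) => [|[|[|]]].
Qed.

(** * Liouville's substitutions on the solutions of a x + b y = n *)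

Lemma count_quads_bij n (P Q : pred ((nat * nat) * (nat * nat)))
    (f g : (nat * nat) * (nat * nat) -> (nat * nat) * (nat * nat)) :
  (forall q, q \in quads n -> P q -> [/\ f q \in quads n, Q (f q) & g (f q) = q]) ->
  (forall q, q \in quads n -> Q q -> [/\ g q \in quads n, P (g q) & f (g q) = q]) ->
  count P (quads n) = count Q (quads n).
Proof. by apply: count_bij; apply: quads_uniq. Qed.

Definition quad (a x b y : nat) := ((a, x), (b, y)).

Ltac quads_tac :=
  rewrite !mem_quads /= => /and5P[? ? ? ? /eqP ?] ?;
  split; rewrite ?mem_quads /quad; [apply/and5P; split; nia | lia | do 2 congr pair; lia].

(** For [a > b], write [a x + b y] as [(a - b) x + b (x + y)]: the congruence becomes [3 | a - b],
    and the cofactors become increasing. For [a < b] the two products are exchanged first, whence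
    the factor 2. *)
Lemma count_residue_eq n :
  count (fun q => q.1.1 %% 3 == q.2.1 %% 3) (quads n)
  = count (fun q => q.1.1 == q.2.1) (quads n)
    + 2 * count (fun q => (3 %| q.1.1) && (q.1.2 < q.2.2)) (quads n).
Proof.
rewrite [LHS](count_split _ _ (fun q => q.1.1 == q.2.1)) mul2n -addnn.
rewrite [X in _ + X = _](count_split _ _ (fun q => q.2.1 < q.1.1)).
congr (_ + (_ + _)).
- by apply: eq_count => -[[a x] [b y]] /=; case: (a =P b) => [->|]; rewrite ?eqxx ?andbF.
- apply: (@count_quads_bij n _ _
    (fun q => quad (q.1.1 - q.2.1) q.1.2 q.2.1 (q.1.2 + q.2.2))
    (fun q => quad (q.1.1 + q.2.1) q.1.2 q.2.1 (q.2.2 - q.1.2))) => -[[a x] [b y]];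
  quads_tac.
- apply: (@count_quads_bij n _ _
    (fun q => quad (q.2.1 - q.1.1) q.2.2 q.1.1 (q.1.2 + q.2.2))
    (fun q => quad q.2.1 (q.2.2 - q.1.2) (q.1.1 + q.2.1) q.1.2)) => -[[a x] [b y]];
  quads_tac.
Qed.

(** For [x < y], write [a x + b y] as [(a + b) x + b (y - x)], and symmetrically for [y < x]. The
    case [x = y] would give [n = (a + b) x], a multiple of 3. *)
Lemma count_residue_opp n : ~~ (3 %| n) ->
  count (fun q => 3 %| q.1.1 + q.2.1) (quads n)
  = 2 * count (fun q => (3 %| q.1.1) && (q.2.1 < q.1.1)) (quads n).
Proof.
move=> n3; rewrite [LHS](count_split _ _ (fun q => q.1.2 < q.2.2)) mul2n -addnn.
congr (_ + _).
  apply: (@count_quads_bij n _ _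
    (fun q => quad (q.1.1 + q.2.1) q.1.2 q.2.1 (q.2.2 - q.1.2))
    (fun q => quad (q.1.1 - q.2.1) q.1.2 q.2.1 (q.1.2 + q.2.2))) => -[[a x] [b y]];
  quads_tac.
apply: (@count_quads_bij n _ _
    (fun q => quad (q.1.1 + q.2.1) q.2.2 q.1.1 (q.1.2 - q.2.2))
    (fun q => quad q.2.1 (q.1.2 + q.2.2) (q.1.1 - q.2.1) q.1.2)) => -[[a x] [b y]];
  last by quads_tac.
rewrite !mem_quads /= => /and5P[? ? ? ? /eqP E] /andP[ab xy].
have ne : x != y.
  by apply: contra n3 => /eqP xy'; rewrite -E xy' -mulnDl dvdn_mulr.
split; rewrite ?mem_quads /quad; [apply/and5P; split; nia | lia | do 2 congr pair; lia].
Qed.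

(** The solutions with [3 | a] are counted twice: by the order of [a] and [b], where [a = b] would
    force [3 | n], and by the order of [x] and [y]. The map [(a, x, b, y) -> (a, x + y, b - a, y)]
    equates the classes [a < b] and [x > y]. *)
Lemma count_dvd_balance n : ~~ (3 %| n) ->
  count (fun q => (3 %| q.1.1) && (q.2.1 < q.1.1)) (quads n)
  = count (fun q => (3 %| q.1.1) && (q.1.2 < q.2.2)) (quads n)
    + count (fun q => (3 %| q.1.1) && (q.1.2 == q.2.2)) (quads n).
Proof.
move=> n3.
have : count (fun q => (3 %| q.1.1) && (q.1.1 < q.2.1)) (quads n)
   = count (fun q => (3 %| q.1.1) && (q.2.2 < q.1.2)) (quads n).
  apply: (@count_quads_bij n _ _
    (fun q => quad q.1.1 (q.1.2 + q.2.2) (q.2.1 - q.1.1) q.2.2)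
    (fun q => quad q.1.1 (q.1.2 - q.2.2) (q.1.1 + q.2.1) q.2.2)) => -[[a x] [b y]];
  quads_tac.
have : count (fun q => 3 %| q.1.1) (quads n)
   = count (fun q => (3 %| q.1.1) && (q.1.1 < q.2.1)) (quads n)
   + count (fun q => (3 %| q.1.1) && (q.2.1 < q.1.1)) (quads n).
  rewrite [LHS](count_split _ _ (fun q => q.1.1 < q.2.1)); congr (_ + _).
  apply: eq_in_count => -[[a x] [b y]]; rewrite mem_quads /= => /and5P[_ _ _ _ /eqP E].
  rewrite -leqNgt leq_eqVlt; case: (b =P a) => [ba|] //=.
  by rewrite ba ltnn; move: n3; rewrite -E ba -mulnDr; case: (3 %| a) / boolP => // /dvdn_mulr ->.
have : count (fun q => 3 %| q.1.1) (quads n)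
   = count (fun q => (3 %| q.1.1) && (q.2.2 < q.1.2)) (quads n)
   + (count (fun q => (3 %| q.1.1) && (q.1.2 < q.2.2)) (quads n)
   + count (fun q => (3 %| q.1.1) && (q.1.2 == q.2.2)) (quads n)).
  rewrite [LHS](count_split _ _ (fun q => q.2.2 < q.1.2)); congr (_ + _).
  rewrite [LHS](count_split _ _ (fun q => q.1.2 < q.2.2)).
  by congr (_ + _); apply: eq_count => q /=; case: (3 %| _) => //=; lia.
lia.
Qed.

Lemma sum_chi3_quads n : ~~ (3 %| n) ->
  (\sum_(q <- quads n) chi3 q.1.1 * chi3 q.2.1
   = (count (fun q => q.1.1 == q.2.1) (quads n))%:Z
     - 2 * (count (fun q => (3 %| q.1.1)%N && (q.1.2 == q.2.2)) (quads n))%:Z)%R.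
Proof.
move=> n3; under eq_bigr do rewrite chi3_mul.
rewrite sumrB !sum_count count_residue_eq count_residue_opp // count_dvd_balance //.
lia.
Qed.

(** * Diagonal solutions *)

Definition divisors_below n := [seq (d, l) | d <- divisors n, l <- iota 1 d.-1].

Lemma mem_divisors_below n d l : 0 < n ->
  ((d, l) \in divisors_below n) = [&& 0 < l, l < d & d %| n].
Proof.
move=> n0; apply/allpairsPdep/and3P => [[d' [l' [dn ln [-> ->]]]]|[l0 ld dn]].
  by rewrite mem_divisors // in dn; rewrite mem_iota in ln; split=> //; lia.
by exists d, l; rewrite mem_divisors // mem_iota; split=> //; lia.
Qed.

Lemma divisors_below_uniq n : uniq (divisors_below n).
Proof.
apply: allpairs_uniq_dep => [|d _|]; rewrite ?divisors_uniq ?iota_uniq //.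
by move=> [d l] [d' l'] _ _ /= [-> ->].
Qed.

(** Here [a (x + y) = n]: a divisor [d = x + y] is cut into two positive parts in [d - 1] ways. *)
Lemma count_quads_eql n : 0 < n ->
  count (fun q => q.1.1 == q.2.1) (quads n) = \sum_(d <- divisors n) d.-1.
Proof.
move=> n0.
have -> : \sum_(d <- divisors n) d.-1 = count predT (divisors_below n).
  rewrite count_predT size_allpairs_dep sumnE big_map.
  by apply: eq_bigr => d _; rewrite size_iota.
apply: (@count_bij _ _ _ _ _ _ (fun q => (q.1.2 + q.2.2, q.1.2))
   (fun u => quad (n %/ u.1) u.2 (n %/ u.1) (u.1 - u.2))).
- exact: quads_uniq.
- exact: divisors_below_uniq.
- move=> [[a x] [b y]]; rewrite mem_quads /= => /and5P[a0 x0 b0 y0 /eqP E] /eqP ab.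
  rewrite mem_divisors_below //; split=> //; first by rewrite -E ab -mulnDr dvdn_mull // x0; lia.
  rewrite -E -ab -mulnDr mulnK ?addKn //; lia.
move=> [d l]; rewrite mem_divisors_below // => /and3P[l0 ld dn] _ /=.
have dn0 : 0 < n %/ d by rewrite divn_gt0 (leq_ltn_trans _ ld, dvdn_leq n0 dn).
rewrite eqxx mem_quads dn0 l0 subn_gt0 ld -mulnDr subnKC 1?ltnW // divnK //.
by rewrite eqxx.
Qed.

Lemma count_dvd_iota m k : 0 < m -> count (dvdn m) (iota 1 k) = k %/ m.
Proof.
move=> m0; elim: k => [|k IH]; first by rewrite div0n.
by rewrite -[in LHS](addn1 k) iotaD count_cat IH /= addn0 add1n divnS // addnC.
Qed.

(** Here [(a + b) x = n]: for a divisor [d = a + b], the admissible [a] are the positive multiples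
    of 3 below [d]. *)
Lemma count_quads_eqr n : 0 < n ->
  count (fun q => (3 %| q.1.1) && (q.1.2 == q.2.2)) (quads n)
  = \sum_(d <- divisors n) d.-1 %/ 3.
Proof.
move=> n0.
have -> : \sum_(d <- divisors n) d.-1 %/ 3 = count (fun u => 3 %| u.2) (divisors_below n).
  rewrite count_flatten sumnE !big_map.
  by apply: eq_bigr => d _; rewrite count_map -count_dvd_iota.
apply: (@count_bij _ _ _ _ _ _ (fun q => (q.1.1 + q.2.1, q.1.1))
   (fun u => quad u.2 (n %/ u.1) (u.1 - u.2) (n %/ u.1))).
- exact: quads_uniq.
- exact: divisors_below_uniq.
- move=> [[a x] [b y]]; rewrite mem_quads /= => /and5P[a0 x0 b0 y0 /eqP E] /andP[a3 /eqP xy].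
  rewrite mem_divisors_below //; split=> //; first by rewrite -E xy -mulnDl dvdn_mulr // a0; lia.
  rewrite -E -xy -mulnDl mulKn ?addKn //; lia.
move=> [d l]; rewrite mem_divisors_below // => /and3P[l0 ld dn] /= l3.
have dn0 : 0 < n %/ d by rewrite divn_gt0 (leq_ltn_trans _ ld, dvdn_leq n0 dn).
rewrite l3 eqxx mem_quads dn0 l0 subn_gt0 ld -mulnDl subnKC 1?ltnW // mulnC divnK //.
by rewrite eqxx.
Qed.

(** Complementary divisors have product 2 mod 3, so their values of [chi3] are opposite. *)
Lemma chi3_sum_eq0 n : n %% 3 = 2 -> chi3_sum n = 0%R.
Proof.
move=> n3; have n0 : 0 < n by lia.
suff : (chi3_sum n = - chi3_sum n)%R by lia.
rewrite {1}/chi3_sum (@sum_cofactors _ n (fun d e => chi3 d)) // /chi3_sum -sumrN.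
rewrite big_seq [RHS]big_seq; apply: eq_bigr => d; rewrite mem_divisors // => dn.
have := divnK dn; move: (n %/ d) => e E; move: n3; rewrite -E -modnMm /chi3.
have := ltn_pmod d (isT : 0 < 3); have := ltn_pmod e (isT : 0 < 3).
by case: (d %% 3) => [|[|[|]]] //; case: (e %% 3) => [|[|[|]]].
Qed.

Lemma sum_chi3_sum n : n %% 3 = 2 ->
  (3 * \sum_(1 <= k < n) chi3_sum k * chi3_sum (n - k)%N = (sigma n)%:Z)%R.
Proof.
move=> n3; have n0 : 0 < n by lia.
have n3' : ~~ (3 %| n) by lia.
rewrite -sum_quads sum_chi3_quads // count_quads_eql // count_quads_eqr //.
(* For [d] prime to 3, the number [3 (d - 1) - 6 ((d - 1) %/ 3)] is [d - chi3 d]. *)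
suff : (3 * (\sum_(d <- divisors n) d.-1)%N%:Z - 6 * (\sum_(d <- divisors n) (d.-1 %/ 3))%N%:Z
        = (sigma n)%:Z - chi3_sum n)%R.
  by rewrite chi3_sum_eq0 //; lia.
rewrite /sigma /chi3_sum !(big_morph Posz PoszD erefl) !mulr_sumr -!sumrB.
rewrite big_seq [RHS]big_seq; apply: eq_bigr => d; rewrite mem_divisors // => dn.
have d3 : ~~ (3 %| d) by apply: contra n3' => /dvdn_trans; apply.
have [k [-> | ->]] : exists k, d = 3 * k + 1 \/ d = 3 * k + 2.
  by exists (d %/ 3); lia.
  rewrite /chi3; lia.
rewrite /chi3; lia.
Qed.

(** * Divisor sums *)

Lemma sum_divisors_coprime (R : nmodType) (f : nat -> R) p n : prime p -> 0 < n ->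
  (\sum_(d <- divisors (p * n) | ~~ (p %| d)%N) f d
   = \sum_(d <- divisors n | ~~ (p %| d)%N) f d)%R.
Proof.
move=> pp n0; rewrite -big_filter -[RHS]big_filter; apply/perm_big/uniq_perm.
- by rewrite filter_uniq ?divisors_uniq.
- by rewrite filter_uniq ?divisors_uniq.
move=> d; rewrite !mem_filter !mem_divisors ?muln_gt0 ?(prime_gt0 pp) //.
case: (boolP (p %| d)) => //= pd; rewrite Gauss_dvdr //.
by rewrite coprime_sym prime_coprime.
Qed.

Lemma sum_divisors_dvd (R : pzRingType) (f : nat -> R) p n :
  (forall d, f (p * d)%N = f p * f d)%R -> 0 < p -> 0 < n ->
  (\sum_(d <- divisors (p * n) | (p %| d)%N) f d
   = f p * \sum_(d <- divisors n) f d)%R.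
Proof.
move=> fM p0 n0; rewrite mulr_sumr.
under [RHS]eq_bigr do rewrite -fM.
rewrite -[RHS](big_map (muln p) xpredT f) -[LHS]big_filter; apply/perm_big/uniq_perm.
- by rewrite filter_uniq ?divisors_uniq.
- by rewrite map_inj_uniq ?divisors_uniq // => d e /eqP; rewrite eqn_pmul2l // => /eqP.
move=> d; rewrite mem_filter mem_divisors ?muln_gt0 ?p0 //.
apply/andP/mapP => [[/dvdnP[e ->]]|[e]].
  by rewrite mulnC dvdn_pmul2l // => en; exists e; rewrite ?mem_divisors // mulnC.
by rewrite mem_divisors // => en ->; rewrite dvdn_mulr ?dvdn_pmul2l.
Qed.

Lemma sum_divisorsM (R : pzRingType) (f : nat -> R) p n :
  (forall d, f (p * d)%N = f p * f d)%R -> prime p -> 0 < n ->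
  (\sum_(d <- divisors (p * n)) f d
   = f p * \sum_(d <- divisors n) f d + \sum_(d <- divisors n | ~~ (p %| d)%N) f d)%R.
Proof.
move=> fM pp n0; rewrite (bigID (dvdn p)) /= sum_divisors_dvd ?(prime_gt0 pp) //.
by rewrite sum_divisors_coprime.
Qed.

(** The divisors prime to [p] stay the same at every power ([cop]), so the sum is a geometric series
    in [f p], stated with its denominator cleared to hold in a ring. *)
Lemma sum_divisors_expM (R : comPzRingType) (f : nat -> R) p k m :
  (forall d, f (p * d)%N = f p * f d)%R -> prime p -> 0 < m -> ~~ (p %| m) ->
  ((f p - 1) * \sum_(d <- divisors (p ^ k * m)) f d
   = (f p ^+ k.+1 - 1) * \sum_(d <- divisors m) f d)%R.
Proof.
move=> fM pp m0 pm.
have cop j : (\sum_(d <- divisors (p ^ j * m) | ~~ (p %| d)%N) f d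
              = \sum_(d <- divisors m) f d)%R.
  elim: j => [|j IH]; last first.
    by rewrite expnS -mulnA sum_divisors_coprime // muln_gt0 expn_gt0 prime_gt0.
  rewrite mul1n big_seq_cond [RHS]big_seq; apply: eq_bigl => d.
  rewrite mem_divisors //; case: (boolP (d %| m)) => //= dm.
  by apply: contra pm => /dvdn_trans; apply.
elim: k => [|k IH]; first by rewrite mul1n.
rewrite expnS -mulnA sum_divisorsM ?cop ?muln_gt0 ?expn_gt0 ?(prime_gt0 pp) //.
rewrite mulrDr mulrCA IH [in RHS]exprS; ring.
Qed.

Lemma chi3M a b : chi3 (a * b) = (chi3 a * chi3 b)%R.
Proof.
rewrite /chi3 -modnMm; have := ltn_pmod a (isT : 0 < 3); have := ltn_pmod b (isT : 0 < 3).
by case: (a %% 3) => [|[|[|]]] //; case: (b %% 3) => [|[|[|]]].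
Qed.

(** The [if] term is the sum of [chi3] over the divisors of [n] that [p] divides; it completes the
    partial sum left by [sum_divisorsM]. *)
Lemma chi3_sum_hecke p n : prime p -> 0 < n ->
  (chi3_sum (p * n) + (if (p %| n)%N then chi3 p * chi3_sum (n %/ p)%N else 0)
   = (1 + chi3 p) * chi3_sum n)%R.
Proof.
move=> pp n0; rewrite /chi3_sum sum_divisorsM //; last exact: chi3M.
suff H : (\sum_(d <- divisors n) chi3 d
    = \sum_(d <- divisors n | ~~ (p %| d)%N) chi3 d +
    (if (p %| n)%N then chi3 p * \sum_(d <- divisors (n %/ p)%N) chi3 d else 0))%R.
  by rewrite -addrA -H [RHS]mulrDl mul1r addrC.
rewrite (bigID (dvdn p)) /= addrC; congr (_ + _)%R; case: ifP => [/dvdnP[m E]|pn].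
  rewrite E mulnK ?(prime_gt0 pp) // mulnC sum_divisors_dvd ?(prime_gt0 pp) //; first exact: chi3M.
  by move: n0; rewrite E muln_gt0 => /andP[].
rewrite big_seq_cond big1 // => d /andP[]; rewrite mem_divisors // => dn /dvdn_trans pd.
by rewrite pd in pn.
Qed.

(** Strong induction, splitting off the full power of the least prime factor by
    [sum_divisors_expM]. *)
Lemma sigma_prod m : 0 < m ->
  ((sigma m)%:R = \prod_(p <- primes m)
     (((p ^ (logn p m).+1)%:R - 1) / (p%:R - 1)) :> rat)%R.
Proof.
have [b mb] := ubnP m; elim: b m mb => // b IHb m mb m0.
have IH j : j < m -> 0 < j -> _ := fun jm => IHb j (leq_trans jm mb).
case: (leqP m 1) => [m1|m1].
  have -> : m = 1 by lia.
  by rewrite /sigma !big_cons !big_nil.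
have pp := pdiv_prime m1; set p := pdiv m in pp.
have [m' pm'] := pfactor_coprime pp m0; rewrite mulnC => E.
have m'0 : 0 < m' by move: m0; rewrite E muln_gt0 => /andP[].
have m'm : m' < m.
  rewrite E -[X in X < _]mul1n ltn_pmul2r // -(expn0 p) ltn_exp2l ?prime_gt1 //.
  by rewrite logn_gt0 mem_primes pp m0 pdiv_dvd.
have pNm' : ~~ (p %| m') by rewrite -prime_coprime.
have sigmaE n : ((sigma n)%:R = \sum_(d <- divisors n) d%:R :> rat)%R.
  by rewrite /sigma natr_sum.
have p1 : (p%:R - 1 != 0 :> rat)%R.
  by rewrite subr_eq0 -[1%R]/(1%:R)%R eqr_nat gtn_eqF // prime_gt1.
rewrite (@perm_big _ _ _ _ _ (p :: primes m')); last first.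
  apply: uniq_perm; rewrite ?primes_uniq //= ?primes_uniq ?mem_primes ?(negbTE pNm') ?andbF //.
  move=> q; rewrite inE !mem_primes m0 m'0; case: (boolP (prime q)) => [qp|] /=; last first.
    by case: eqP => // ->; rewrite pp.
  rewrite {1}E Euclid_dvdM //; congr (_ || _).
  rewrite Euclid_dvdX // dvdn_prime2 // logn_gt0.
  rewrite mem_primes pp m0 pdiv_dvd; exact: andbT.
rewrite big_cons.
have -> : (\prod_(q <- primes m') (((q ^ (logn q m).+1)%:R - 1) / (q%:R - 1))
   = (sigma m')%:R :> rat)%R.
  rewrite IH //; rewrite big_seq [RHS]big_seq; apply: eq_bigr => q.
  rewrite mem_primes => /and3P[qp _ qm'].
  rewrite {1}E lognM ?expn_gt0 ?(prime_gt0 pp) // lognX (logn_prime q pp).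
  case: eqP => [qE|]; last by rewrite /= muln0 add0n.
  by move: pNm'; rewrite -qE qm'.
have := @sum_divisors_expM _ (fun d => d%:R : rat)%R p (logn p m) m'
  (fun d => natrM _ p d) pp m'0 pNm'.
rewrite -E -!sigmaE natrX /= => H.
by apply: (mulfI p1); rewrite H mulrA [X in _ = (X * _)%R]mulrC divfK.
Qed.

(** * Representations by the Eisenstein norm form *)

(* Norm of the Eisenstein integer [x - w y], where [w^2 + w + 1 = 0]. *)
Definition eis (x y : int) : int := (x * x + x * y + y * y)%R.

Definition zbox (m : nat) : seq int := [seq (i%:Z - m%:Z)%R | i <- iota 0 m.*2.+1].

Definition reps (n : nat) : seq (int * int) :=
  [seq u <- [seq (x, y) | x <- zbox n.*2, y <- zbox n.*2] | eis u.1 u.2 == n].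

Lemma mem_zbox m (z : int) : (z \in zbox m) = (- m%:Z <= z <= m%:Z)%R.
Proof.
apply/mapP/idP => [[i]|zm]; first by rewrite mem_iota; lia.
by exists `|(z + m%:Z)%R|%N; rewrite ?mem_iota; lia.
Qed.

(** From [4 eis x y = 3 x^2 + (x + 2 y)^2]. Thus the search box in [reps] misses no solution. *)
Lemma eis_bound x y (n : nat) : eis x y = n -> (- (n.*2)%:Z <= x <= (n.*2)%:Z)%R.
Proof.
rewrite /eis => E.
have : (3 * (x * x) <= 4 * n%:Z)%R by have := sqr_ge0 (x + 2 * y)%R; nia.
by case: (lerP 0 x); nia.
Qed.

Lemma mem_reps n x y : ((x, y) \in reps n) = (eis x y == n).
Proof.
rewrite mem_filter andb_idr // => /eqP E.
apply/allpairsP; exists (x, y); rewrite /= !mem_zbox (eis_bound _ _ _ E) (eis_bound y x) //.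
by rewrite -E /eis; ring.
Qed.

Lemma reps_uniq n : uniq (reps n).
Proof.
have zu m : uniq (zbox m).
  by rewrite map_inj_uniq ?iota_uniq // => i j; lia.
by rewrite filter_uniq // allpairs_uniq // => -[a b] [c d].
Qed.

Lemma count_reps_bij (m n : nat) (P Q : pred (int * int)) (f g : int * int -> int * int) :
  (forall x y, eis x y = m -> P (x, y) ->
     [/\ eis (f (x, y)).1 (f (x, y)).2 = n, Q (f (x, y)) & g (f (x, y)) = (x, y)]) ->
  (forall x y, eis x y = n -> Q (x, y) ->
     [/\ eis (g (x, y)).1 (g (x, y)).2 = m, P (g (x, y)) & f (g (x, y)) = (x, y)]) ->
  count P (reps m) = count Q (reps n).
Proof.
move=> fP gP; apply: (@count_bij _ _ _ _ P Q f g); rewrite ?reps_uniq //.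
  move=> [x y]; rewrite mem_reps => /eqP E /(fP _ _ E)[].
  by case: (f _) => a b /= /eqP; rewrite mem_reps.
move=> [x y]; rewrite mem_reps => /eqP E /(gP _ _ E)[].
by case: (g _) => a b /= /eqP; rewrite mem_reps.
Qed.

Lemma dvdz_lin (d a b k l c : int) :
  (d %| a)%Z -> (d %| b)%Z -> c = (k * a + l * b)%R -> (d %| c)%Z.
Proof. by move=> da db ->; rewrite rpredD // dvdz_mull. Qed.

Lemma Euclid_dvdzM (p : nat) (a b : int) : prime p ->
  (p %| (a * b)%R)%Z = (p %| a)%Z || (p %| b)%Z.
Proof. by move=> pp; rewrite !dvdzE abszM Euclid_dvdM. Qed.

Definition reps_div (p n : nat) : nat := if p %| n then size (reps (n %/ p)) else 0.

(** Dividing both coordinates by [p] divides the norm by [p^2], taking [p n] to [n / p]. *)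
Lemma count_reps_dvd (p n : nat) : prime p ->
  count (fun u => (p %| u.1)%Z && (p %| u.2)%Z) (reps (p * n)) = reps_div p n.
Proof.
move=> pp; have p0 : (p%:Z != 0)%R by have := prime_gt0 pp; lia.
rewrite /reps_div; case: ifP => [/dvdnP[m ->]|pn].
  rewrite mulnK ?prime_gt0 // -(count_predT (reps m)).
  apply: (@count_reps_bij _ _ _ _ (fun u => ((u.1 %/ p)%Z, (u.2 %/ p)%Z))
            (fun u => (u.1 * p, u.2 * p)%R)) => x y /=; last first.
    move=> E _; rewrite !mulzK // !dvdz_mull //; split=> //.
    by rewrite !PoszM -E /eis; ring.
  move=> E /andP[/dvdzP[a xa] /dvdzP[b yb]].
  rewrite xa yb !mulzK //; split=> //.
  apply: (mulfI p0); apply: (mulfI p0).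
  transitivity (eis (a * p) (b * p))%R; first by rewrite /eis; ring.
  by rewrite -xa -yb E !PoszM; ring.
apply/eqP; rewrite -leqn0 leqNgt -has_count; apply/negP => /hasP[[x y]].
rewrite mem_reps => /eqP E /andP[/dvdzP[a /= xa] /dvdzP[b /= yb]].
have En : (n%:Z = eis a b * p)%R.
  by apply: (mulfI p0); rewrite -PoszM -E xa yb /eis; ring.
suff : (p %| Posz n)%Z by rewrite dvdzE pn.
by rewrite En dvdz_mull.
Qed.

(** If [p | v] then [p | u^2], hence [p | u], and [p^2] would divide the norm [p]. *)
Lemma split_ndvd (p : nat) (u v : int) : prime p -> eis u v = p -> ~~ (p %| v)%Z.
Proof.
move=> pp uvp; have p0 : (p%:Z != 0)%R by have := prime_gt0 pp; lia.
apply/negP => pv; have pu : (p %| u)%Z.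
  rewrite -[(p %| u)%Z]orbb -Euclid_dvdzM //.
  by apply: (@dvdz_lin _ p v 1 (- u - v)) => //; rewrite -uvp /eis; ring.
move: pu pv => /dvdzP[a ua] /dvdzP[b vb].
have E1 : (1 = eis a b * p)%R by apply: (mulfI p0); rewrite mulr1 -{1}uvp ua vb /eis; ring.
have : (p %| (1 : int)%R)%Z by rewrite E1 dvdz_mull.
by rewrite dvdzE Euclid_dvd1.
Qed.

(* Divisibility of [x - w y] by [u - w v]. *)
Lemma count_reps_dvdl (p n : nat) (u v : int) : prime p -> eis u v = p ->
  count (fun z => (p %| (z.1 * v - z.2 * u)%R)%Z) (reps (p * n)) = size (reps n).
Proof.
move=> pp uvp; have p0 : (p%:Z != 0)%R by have := prime_gt0 pp; lia.
rewrite -(count_predT (reps n)).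
(* Division by [u - w v] is multiplication by its conjugate [(u + v) + w v] followed by division by
   [p]. *)
apply: (@count_reps_bij _ _ _ _
   (fun z => (((z.1 * u + z.1 * v + z.2 * v)%R %/ p)%Z, ((z.2 * u - z.1 * v)%R %/ p)%Z))
   (fun z => (z.1 * u - z.2 * v, z.1 * v + z.2 * u + z.2 * v)%R)) => x y /= E; last first.
  move=> _; split.
  - by rewrite PoszM -E -uvp /eis; ring.
  - by apply: (@dvdz_lin _ p 0 (- y) 0); rewrite ?dvdz0 // -uvp /eis; ring.
  - congr pair.
      suff -> : ((x * u - y * v) * u + (x * u - y * v) * v + (x * v + y * u + y * v) * v = x * p)%R
        by rewrite mulzK.
      by rewrite -uvp /eis; ring.
    suff -> : ((x * v + y * u + y * v) * u - (x * u - y * v) * v = y * p)%R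
        by rewrite mulzK.
    by rewrite -uvp /eis; ring.
move=> D.
have D' : (p %| (y * u - x * v)%R)%Z by rewrite -rpredN opprB.
(* The product with the conjugate has norm [n p^2]; since [p] divides one coordinate, it divides the
   square of the other. *)
have D2 : (p %| (x * u + x * v + y * v)%R)%Z.
  rewrite -[X in is_true X]orbb -Euclid_dvdzM //.
  apply: (@dvdz_lin _ p (y * u - x * v) (n%:Z * p)
    (- (y * u - x * v) - (x * u + x * v + y * v))) => //.
  have -> : (n%:Z * p * p = eis u v * eis x y)%R by rewrite uvp E PoszM; ring.
  by rewrite /eis; ring.
move: D' D2 => /dvdzP[b Eb] /dvdzP[a Ea].
rewrite Ea Eb !mulzK //.
have Ex : (a * u - b * v = x)%R.
  apply: (mulfI p0); rewrite -{2}uvp.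
  have -> : (p%:Z * (a * u - b * v) = (a * p) * u - (b * p) * v)%R by ring.
  by rewrite -Ea -Eb /eis; ring.
have Ey : (a * v + b * u + b * v = y)%R.
  apply: (mulfI p0); rewrite -{2}uvp.
  have -> : (p%:Z * (a * v + b * u + b * v) = (a * p) * v + (b * p) * u + (b * p) * v)%R by ring.
  by rewrite -Ea -Eb /eis; ring.
split=> //; last by rewrite Ex Ey.
apply: (mulfI p0); rewrite -PoszM -E -Ex -Ey -uvp /eis; ring.
Qed.

(** Inclusion-exclusion over the two conjugate factors of [p]. Each representation of [p n] is
    divisible by at least one of them, the product of the two linear forms being 0 mod [p], and by
    both exactly when [p] divides [x] and [y]. *)
Lemma reps_split (p n : nat) (u v : int) : prime p -> p != 3 -> eis u v = p ->
  size (reps (p * n)) + reps_div p n = 2 * size (reps n).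
Proof.
move=> pp p3 uvp.
rewrite mul2n -addnn -{1}(count_reps_dvdl p n u v pp uvp).
have uvp' : eis (u + v) (- v) = p by rewrite -uvp /eis; ring.
rewrite -(count_reps_dvdl p n _ _ pp uvp') -count_reps_dvd //.
rewrite -count_predUI; congr (_ + _).
  symmetry; apply/eqP; rewrite -all_count; apply/allP => -[x y] /=.
  rewrite mem_reps => /eqP E.
  case: (boolP (p %| (x * v - y * u)%R)%Z) => //= D1.
  have : (p %| ((x * v - y * u) * (x * - v - y * (u + v)))%R)%Z.
    apply: (dvdz_lin _ p p (- (v * v * n%:Z))%R (y * y)%R); rewrite ?dvdzz //.
    have -> : (- (v * v * n%:Z) * p = - (v * v * eis x y))%R by rewrite E PoszM; ring.
    by rewrite -uvp /eis; ring.
  by rewrite Euclid_dvdzM // (negbTE D1).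
symmetry.
apply: eq_in_count => -[x y] /=; rewrite mem_reps => /eqP E.
apply/andP/andP => [[D1 D2]|[px py]]; last first.
    by rewrite !rpredB // dvdz_mulr.
  have py : (p %| y)%Z.
    have : (p %| (y * (2 * u + v))%R)%Z.
      by apply: (dvdz_lin _ _ _ (-1)%R (-1)%R _ D1 D2); ring.
    rewrite Euclid_dvdzM // => /orP[//|pv]; exfalso.
    (* Uses [4 p = (2 u + v)^2 + 3 v^2]. *)
    have : (p %| (3 * (v * v))%R)%Z.
      apply: (dvdz_lin _ p (2 * u + v)%R 4%R (- (2 * u + v))%R _ (dvdzz _) pv).
      by rewrite -uvp /eis; ring.
    rewrite !Euclid_dvdzM // orbb (negbTE (split_ndvd p u v pp uvp)) orbF.
    by rewrite dvdzE dvdn_prime2 // (negbTE p3).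
  split=> //; have : (p %| (x * v)%R)%Z.
    by apply: (dvdz_lin _ _ _ 1%R u _ D1 py); ring.
  by rewrite Euclid_dvdzM // (negbTE (split_ndvd p u v pp uvp)) orbF.
Qed.

(** * Inert and split primes *)

Lemma dvdz_Fp (p : nat) (z : int) : prime p -> (p %| z)%Z = (z%:~R == 0 :> 'F_p)%R.
Proof. by move=> pp; rewrite (dvdz_pcharf (pchar_Fp pp)). Qed.

(* A common cube [x^3 = y^3] forces [x = y] mod [p], as [3] is prime to [p - 1]. *)
Lemma eis_inert (p : nat) (x y : int) : prime p -> p %% 3 = 2 ->
  (p %| eis x y)%Z -> (p %| x)%Z && (p %| y)%Z.
Proof.
move=> pp p3; rewrite !dvdz_Fp // /eis !rmorphD !rmorphM /=.
set a : 'F_p := (x%:~R)%R; set b : 'F_p := (y%:~R)%R => /eqP E.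
(* The exponent in [c^p = c] is written as [3 (p %/ 3) + 2]; then [a b^2] and [b a^2] are both
   [a^2 b^2] times the same power of the common cube. *)
have fermat (c : 'F_p) : (c ^+ 3 ^+ (p %/ 3) * c ^+ 2 = c)%R.
  rewrite -exprM -exprD -[RHS](expf_card c) card_Fp //; congr (_ ^+ _)%R; lia.
have cube : (a ^+ 3 = b ^+ 3)%R.
  apply/eqP; rewrite -subr_eq0; apply/eqP.
  transitivity ((a - b) * (a * a + a * b + b * b))%R; first by ring.
  by rewrite E mulr0.
have H : (a * b * (a - b) = 0)%R.
  have : (a * b ^+ 2 = b * a ^+ 2)%R.
    rewrite -{1}(fermat a) -{2}(fermat b) cube; ring.
  by move=> H; transitivity (b * a ^+ 2 - a * b ^+ 2)%R; [ring | rewrite H subrr].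
have three : (3%:R != 0 :> 'F_p)%R.
  rewrite -(dvdn_pcharf (pchar_Fp pp)) dvdn_prime2 //; apply/eqP => p3'.
  by rewrite p3' in p3.
move/eqP: H; rewrite !mulf_eq0 subr_eq0 => /orP[/orP[|]|] /eqP H.
- by move: E; rewrite H !mul0r !add0r => /eqP; rewrite mulf_eq0 orbb eqxx => ->.
- by move: E; rewrite H !mulr0 !addr0 => /eqP; rewrite mulf_eq0 orbb eqxx => ->.
move: E; rewrite H => E; have /eqP : (3%:R * (b * b) = 0)%R by rewrite -E; ring.
by rewrite !mulf_eq0 (negbTE three) /= orbb => /eqP ->; rewrite eqxx.
Qed.

(** The unit group has order [p - 1], a multiple of 3; an element of order 3 is a root of [t^3 - 1]
    other than 1. *)
Lemma cube_root_Fp p : prime p -> p %% 3 = 1 ->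
  exists t : 'F_p, (t * t + t + 1 = 0)%R.
Proof.
move=> pp p3.
have [|u _ u3] := @Cauchy _ 3 [set: {unit 'F_p}]%G isT.
  by rewrite card_finField_unit card_Fp //; have := prime_gt0 pp; lia.
exists (val u); apply/eqP.
have : ((val u - 1) * (val u * val u + val u + 1) == 0)%R.
  have -> : ((val u - 1) * (val u * val u + val u + 1) = val u ^+ 3 - 1)%R by ring.
  by rewrite -FinRing.val_unitX -u3 expg_order FinRing.val_unit1 subrr.
rewrite mulf_eq0 subr_eq0 => /orP[|//] /eqP u1.
suff E : u = 1%g by rewrite E order1 in u3.
by apply: val_inj; rewrite u1.
Qed.

(** Gives the box for the pigeonhole argument: its [(m + 1)^2] points exceed [p] in number, while
    differences of coordinates have squares below [p]. The left bound is strict since a prime is not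
    a square. *)
Lemma prime_sqrt_bounds p : prime p -> exists m, m * m < p < m.+1 * m.+1.
Proof.
move=> pp.
have [m mp mmax] : exists2 m, m * m <= p & forall k, k * k <= p -> k <= m.
  have ex : exists k, k * k <= p by exists 0.
  have bd k : k * k <= p -> k <= p by nia.
  by exists (ex_maxn ex bd); case: ex_maxnP.
exists m; apply/andP; split; last first.
  by rewrite ltnNge; apply/negP => /mmax; rewrite ltnn.
rewrite ltn_neqAle mp andbT; apply/eqP => E.
have : m %| p by rewrite -E dvdn_mulr.
case/primeP: pp => p1 H /H /orP[] /eqP mE; nia.
Qed.

(* Thue: by pigeonhole some nonzero [u - t v] with [u^2, v^2 < p] vanishes
   mod [p], where [t^2 + t + 1 = 0]; then [eis u v < 3 p] is a multiple of
   [p], and [2 p] is excluded mod 2. *)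
Lemma eis_split p : prime p -> p %% 3 = 1 -> exists u v, eis u v = p.
Proof.
move=> pp p3; have [t tE] := cube_root_Fp p pp p3.
have [m /andP[mp pm]] := prime_sqrt_bounds p pp.
pose F (w : 'I_m.+1 * 'I_m.+1) : 'F_p := ((w.1 : nat)%:R - t * (w.2 : nat)%:R)%R.
have /injectivePn[[i j] [[k l] ne Fe]] : ~~ injectiveb F.
  apply/negP => /injectiveP /leq_card; rewrite card_prod card_ord card_Fp //; lia.
pose u : int := (Posz i - Posz k)%R; pose v : int := (Posz j - Posz l)%R.
have uv0 : (u != 0) || (v != 0).
  rewrite -negb_and; apply: contra ne => /andP[/eqP u0 /eqP v0].
  by apply/eqP; congr pair; apply: val_inj => /=; lia.
have uE : (u%:~R = t * v%:~R :> 'F_p)%R.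
  rewrite /u /v !rmorphB /= -!pmulrn.
  apply/eqP; rewrite -subr_eq0; apply/eqP.
  by move/eqP: Fe; rewrite /F /= -subr_eq0 => /eqP <-; ring.
have /dvdzP[q qE] : (p %| eis u v)%Z.
  rewrite dvdz_Fp // /eis !rmorphD !rmorphM /= uE.
  have -> : (t * v%:~R * (t * v%:~R) + t * v%:~R * v%:~R + v%:~R * v%:~R
            = (t * t + t + 1) * (v%:~R * v%:~R) :> 'F_p)%R by ring.
  by rewrite tE mul0r.
have ub : (u * u < p)%R by rewrite /u; have := ltn_ord i; have := ltn_ord k; nia.
have vb : (v * v < p)%R by rewrite /v; have := ltn_ord j; have := ltn_ord l; nia.
clearbody u v; clear Fe uE ne.
have p0 := prime_gt0 pp.
have q3 : (q < 3)%R.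
  suff : (q * p < 3 * p)%R by nia.
  by rewrite -qE /eis; have := sqr_ge0 (u - v)%R; rewrite expr2; nia.
have q0 : (0 < q)%R.
  suff : (0 < q * p)%R by nia.
  rewrite -qE /eis; move: uv0 => /orP[]; nia.
exists u, v; rewrite qE.
have [->|q2] : q = 1%R \/ q = 2%R by lia.
  by rewrite mul1r.
exfalso; move: qE; rewrite q2 /eis => qE.
(* An even value of [eis] forces [u] and [v] to be even, so 4 would divide [2 p]. *)
have podd : odd p by case: (even_prime pp) => // p2; rewrite p2 in p3.
have [a [b ab]] : exists a b : int,
    (u = 2 * a \/ u = 2 * a + 1)%R /\ (v = 2 * b \/ v = 2 * b + 1)%R.
  by exists (u %/ 2)%Z, (v %/ 2)%Z; lia.
have [c cE] : exists c : int, (p%:Z = 2 * c + 1)%R by exists (Posz p./2); lia.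
rewrite cE in qE.
by move: qE; case: ab => [[->|->] [->|->]]; lia.
Qed.

(** Strong induction along the least prime factor [p]. For [p = 1] mod 3, [reps_split] is the
    recursion of [chi3_sum_hecke]; for [p = 2] mod 3, all representations of [p m] are multiples of
    [p], and [1 + chi3 p = 0]. *)
Lemma size_reps n : 0 < n -> ~~ (3 %| n) ->
  ((size (reps n))%:Z = 6 * chi3_sum n)%R.
Proof.
have [b nb] := ubnP n; elim: b n nb => // b IH n nb n0 n3.
case: (leqP n 1) => [n1|n1].
  have -> : n = 1 by lia.
  by rewrite /chi3_sum big_cons big_nil.
pose p := pdiv n; have pp : prime p := pdiv_prime n1.
have /dvdnP[m] : p %| n := pdiv_dvd n.
rewrite mulnC; move: p pp => p pp nE; subst n.
have p1 := prime_gt1 pp.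
have m0 : 0 < m by move: n0; rewrite muln_gt0 => /andP[].
have m3 : ~~ (3 %| m) by apply: contra n3; apply: dvdn_mull.
have p3 : ~~ (3 %| p) by apply: contra n3; apply: dvdn_mulr.
have Em : ((size (reps m))%:Z = 6 * chi3_sum m)%R by apply: IH => //; nia.
have Ed : ((reps_div p m)%:Z = 6 * (if (p %| m)%N then chi3_sum (m %/ p)%N else 0))%R.
  rewrite /reps_div; case: ifP => // pm.
  have pm0 : 0 < m %/ p by rewrite divn_gt0 ?(dvdn_leq m0 pm) // ltnW.
  apply: IH => //; first by have := leq_div m p; nia.
  by apply: contra m3 => /dvdn_trans; apply; rewrite dvdn_div.
have := chi3_sum_hecke p m pp m0; rewrite /chi3.
case: (p %% 3 =P 1) => [p31 | p31].
  have [u [v uvE]] := eis_split p pp p31.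
  have pne : p != 3 by apply: contra p3 => /eqP ->.
  have := reps_split p m u v pp pne uvE.
  by rewrite p31 /=; move: Ed; case: ifP => _; lia.
have p32 : p %% 3 = 2 by lia.
have : size (reps (p * m)) = reps_div p m.
  rewrite -count_reps_dvd // -[LHS]count_predT; apply: eq_in_count => -[x y].
  rewrite mem_reps => /eqP E; rewrite eis_inert //.
  by rewrite E dvdzE /= dvdn_mulr.
by rewrite p32 /=; move: Ed; case: ifP => _; lia.
Qed.

(** * Beta-sets of 3-cores *)

Lemma geq_trans : transitive geq.
Proof. by move=> y x z /= xy yz; apply: leq_trans xy. Qed.

Lemma gtn_trans : transitive gtn.
Proof. by move=> y x z /= xy yz; apply: ltn_trans xy. Qed.

(** For positive parts, [x + size la'] is the hook length of the first cell of the row [x]. *)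
Fixpoint beta (la : seq nat) : seq nat :=
  if la is x :: la' then x + size la' :: beta la' else [::].

Fixpoint unbeta (B : seq nat) : seq nat :=
  if B is z :: B' then z - size B' :: unbeta B' else [::].

Lemma size_beta la : size (beta la) = size la.
Proof. by elim: la => //= x s ->. Qed.

Lemma size_unbeta B : size (unbeta B) = size B.
Proof. by elim: B => //= x s ->. Qed.

Lemma betaK la : unbeta (beta la) = la.
Proof. by elim: la => //= x s ->; rewrite size_beta addnK. Qed.

Lemma beta_ltn x s z : all (geq x) s -> z \in beta s -> z < x + size s.
Proof.
elim: s => //= y s IH /andP[yx xs]; rewrite inE => /orP[/eqP ->|/(IH xs)]; lia.
Qed.

Lemma beta_sorted la : sorted geq la -> sorted gtn (beta la).
Proof.
elim: la => //= x s IH; rewrite !(path_sortedE geq_trans, path_sortedE gtn_trans).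
move=> /andP[xs /IH ->]; rewrite andbT; apply/allP => z zb /=.
exact: beta_ltn _ _ _ xs zb.
Qed.

Lemma beta_gt0 la : all (fun x => 0 < x) la -> 0 \notin beta la.
Proof.
elim: la => //= x s IH /andP[x0 /IH s0]; rewrite inE negb_or s0 andbT; lia.
Qed.

Lemma sumn_beta la :
  2 * sumn (beta la) + size la = 2 * sumn la + size la * size la.
Proof. by elim: la => //= x s; nia. Qed.

(** Ensures that the subtractions in [unbeta] are not truncated and give positive parts. *)
Lemma size_gtn_sorted z B : path gtn z B -> 0 < z -> all (fun x => 0 < x) B -> size B < z.
Proof.
by elim: B z => //= w B IH z /andP[zw wB] z0 /andP[w0 B0]; have := IH w wB w0 B0; lia.
Qed.

Lemma unbetaK B : sorted gtn B -> all (fun x => 0 < x) B -> beta (unbeta B) = B.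
Proof.
elim: B => //= z B IH zB /andP[z0 B0]; rewrite IH ?(path_sorted zB) //.
by rewrite size_unbeta subnK // ltnW // size_gtn_sorted.
Qed.

Lemma unbeta_sorted B : sorted gtn B -> sorted geq (unbeta B).
Proof.
case: B => //= z B; elim: B z => //= w B IH z /andP[zw wB].
by rewrite IH // andbT /=; lia.
Qed.

Lemma unbeta_gt0 B : sorted gtn B -> all (fun x => 0 < x) B ->
  all (fun x => 0 < x) (unbeta B).
Proof.
elim: B => //= z B IH zB /andP[z0 B0]; rewrite IH ?(path_sorted zB) // andbT.
by rewrite subn_gt0 size_gtn_sorted.
Qed.

Lemma count_gtn_leq j s : count (fun x => j < x) s + count (fun x => x <= j) s = size s.
Proof.
rewrite -(count_predC (fun x => j < x)); congr (_ + _).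
by apply: eq_count => x /=; rewrite -leqNgt.
Qed.

(* The hooks of a first row [x] above [s] are the differences between
   [x + size s] and the gaps [j + #{y in s | y <= j}] of the beta-set of [s]. *)
Lemma gap_notin_beta s j : sorted geq s -> j + count (fun x => x <= j) s \notin beta s.
Proof.
elim: s => //= y s IH; rewrite (path_sortedE geq_trans) => /andP[ys ss].
rewrite inE negb_or; case: (leqP y j) => [yj|jy] /=.
  have -> : count (fun x => x <= j) s = size s.
    apply/eqP; rewrite -all_count; apply: sub_all ys => x /= xy; exact: leq_trans yj.
  rewrite (_ : _ == _ = false) /=; last by apply/eqP; lia.
  by apply/negP => /(beta_ltn _ _ _ ys); lia.
by rewrite add0n IH // andbT; have := count_size (fun x => x <= j) s; lia.
Qed.

(** With [gap_notin_beta], this matches the gaps of the beta-set with the columns [j], so a missing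
    bead can be traced to a cell. *)
Lemma notin_beta_gap s g : sorted geq s -> g \notin beta s ->
  exists j, g = j + count (fun x => x <= j) s.
Proof.
elim: s => [|y s IH] /=; first by exists g; rewrite addn0.
rewrite (path_sortedE geq_trans) inE negb_or => /andP[ys ss] /andP[gy gs].
have [j gE] := IH ss gs; case: (leqP y j) => [yj|jy]; last first.
  by exists j; rewrite leqNgt jy.
have all_le i : y <= i -> count (fun x => x <= i) s = size s.
  by move=> yi; apply/eqP; rewrite -all_count; apply: sub_all ys => x /= xy; apply: leq_trans yi.
rewrite all_le // in gE; move/eqP: gy => gy.
(* Here [y < j]; the new row raises the count by one, so the same gap comes from column [j - 1]. *)
by exists j.-1; rewrite all_le; lia.
Qed.

(** A new longest row lengthens the columns of [s] by one and moves its rows down by one; the two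
    effects cancel in the hooks of [s]. *)
Lemma three_core_cons x s : all (geq x) s ->
  three_core (x :: s)
  = all (fun j => ~~ (3 %| x - j + count (fun y => j < y) s)) (iota 0 x)
    && three_core s.
Proof.
move=> xs; rewrite /three_core /= -[1]addn0 iotaDl all_map; congr (_ && _).
  apply: eq_in_all => j; rewrite mem_iota add0n => /= jx.
  by rewrite /hook /conj_part /= jx; congr (~~ (3 %| _)); lia.
apply: eq_in_all => i; rewrite mem_iota add0n => /= si.
apply: eq_in_all => j; rewrite mem_iota add0n => /= js.
have jx : j < x by apply: leq_trans js _; apply: (allP xs); apply: mem_nth.
by rewrite /hook /conj_part /= jx; congr (~~ (3 %| _)); lia.
Qed.

(** On the abacus with three runners, the beads are pushed to the start. The guard [3 <= z] keeps
    truncated subtraction from asking for 0. *)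
Definition closed3 (B : seq nat) := forall z, z \in B -> 3 <= z -> z - 3 \in B.

(** A bead [z] and a gap [g] below it give a hook of length [z - g]. A gap at [z - 3] is thus a hook
    of length 3; conversely, a hook of length [3 (k + 1)] has its gap [k + 1] steps of 3 below [z],
    where closure puts a bead. *)
Lemma three_core_closed3 la : sorted geq la -> three_core la <-> closed3 (beta la).
Proof.
elim: la => [|x s IH]; first by split.
rewrite [sorted _ _]/= (path_sortedE geq_trans) => /andP[xs ss].
rewrite three_core_cons //; have lt_b z := beta_ltn x s z xs; split.
  move=> /andP[/allP row0 /(IH ss) cl] z /=; rewrite !inE => /orP[/eqP -> | zb] z3; last first.
    by rewrite cl ?orbT.
  rewrite orbC; case: (boolP (_ \in _)) => //= gs; exfalso.
  have [j jE] := notin_beta_gap _ _ ss gs; have := count_gtn_leq j s => cs.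
  have jx : j < x.
    rewrite ltnNge; apply/negP => xj; suff : count (fun y => y <= j) s = size s by lia.
    by apply/eqP; rewrite -all_count; apply: sub_all xs => y /= yx; apply: leq_trans xj.
  have := row0 j; rewrite mem_iota add0n => /(_ jx); lia.
move=> cl; apply/andP; split.
  apply/allP => j; rewrite mem_iota add0n => /= jx; apply/negP => h3.
  have cs := count_gtn_leq j s.
  have /negP[] := gap_notin_beta _ j ss.
  have [k kE] : exists k, x + size s = j + count (fun y => y <= j) s + 3 * k.+1.
    by exists (((x - j + count (fun y => j < y) s) %/ 3).-1); lia.
  have : j + count (fun y => y <= j) s + 3 * k \in beta (x :: s) -> 
     j + count (fun y => y <= j) s + 3 * k < x + size s ->
     j + count (fun y => y <= j) s \in beta s; last first.
    apply; last by lia.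
    have := cl (x + size s); rewrite /= mem_head kE => /(_ isT); rewrite mulnS.
    by rewrite (_ : _ - 3 = j + count (fun y => y <= j) s + 3 * k) ?inE; [apply; lia | lia].
  move: (j + _) {kE} => g; elim: k => [|k IHk] /=.
    by rewrite muln0 addn0 inE => /orP[/eqP -> | //]; rewrite ltnn.
  rewrite mulnS => gb gx; apply: IHk; last by lia.
  have := cl _ gb; rewrite (_ : _ - 3 = g + 3 * k); last lia.
  by apply; lia.
apply/(IH ss) => z zb z3; have := cl z; rewrite /= !inE zb orbT => /(_ isT z3).
by case/orP => // /eqP zE; have := lt_b z zb; lia.
Qed.

(** * Parametrisation of the 3-cores by pairs *)

Definition core_beads (a b : nat) : seq nat :=
  sort geq ([seq 3 * i + 1 | i <- iota 0 a] ++ [seq 3 * i + 2 | i <- iota 0 b]).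

Lemma mem_core_beads a b z :
  (z \in core_beads a b)
  = (z %% 3 == 1) && (z < 3 * a) || (z %% 3 == 2) && (z < 3 * b).
Proof.
rewrite mem_sort mem_cat; congr (_ || _).
  apply/mapP/andP => [[i]|[z3 za]]; first by rewrite mem_iota => ia ->; split; lia.
  by exists (z %/ 3); rewrite ?mem_iota; lia.
apply/mapP/andP => [[i]|[z3 za]]; first by rewrite mem_iota => ia ->; split; lia.
by exists (z %/ 3); rewrite ?mem_iota; lia.
Qed.

Lemma core_beads_sorted a b : sorted gtn (core_beads a b).
Proof.
have u : uniq (core_beads a b).
  rewrite sort_uniq cat_uniq !map_inj_uniq ?iota_uniq //; [|by move=> i j; lia..].
  rewrite andbT; apply/hasPn => z /mapP[i _ ->].
  by apply/negP => /mapP[j _]; lia.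
have s : sorted geq (core_beads a b).
  by apply: sort_sorted => x y; rewrite /= leq_total.
case: (core_beads a b) u s => //= z B; elim: B z => //= w B IH z.
rewrite inE negb_or -andbA => /and3P[zw zB /andP[wB uB]] /andP[zw' sB].
by rewrite IH ?wB // andbT ltn_neqAle eq_sym zw.
Qed.

Lemma core_beads_gt0 a b : all (fun x => 0 < x) (core_beads a b).
Proof. by apply/allP => z; rewrite mem_core_beads; lia. Qed.

Lemma size_core_beads a b : size (core_beads a b) = a + b.
Proof. by rewrite size_sort size_cat !size_map !size_iota. Qed.

Lemma sumn_core_beads a b : 2 * sumn (core_beads a b) + a = 3 * a * a + 3 * b * b + b.
Proof.
have -> : sumn (core_beads a b) =
   sumn [seq 3 * i + 1 | i <- iota 0 a] + sumn [seq 3 * i + 2 | i <- iota 0 b].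
  by rewrite -sumn_cat; apply/perm_sumn; rewrite perm_sort.
have S r k : 2 * sumn [seq 3 * i + r | i <- iota 0 k] + 3 * k = 3 * k * k + 2 * r * k.
  elim: k => [|k IH]; first by rewrite /=; lia.
  rewrite -(addn1 k) iotaD map_cat sumn_cat /= add0n; nia.
by have := S 1 a; have := S 2 b; lia.
Qed.

Definition core_of (ab : nat * nat) : seq nat := unbeta (core_beads ab.1 ab.2).

Lemma beta_core_of a b : beta (core_of (a, b)) = core_beads a b.
Proof. by rewrite unbetaK ?core_beads_sorted ?core_beads_gt0. Qed.

Lemma core_of_inj : injective core_of.
Proof.
move=> [a b] [c d] E; have : core_beads a b =i core_beads c d.
  by rewrite -!beta_core_of E.
move=> M; have ac i : (i < a) = (i < c).
  by have := M (3 * i + 1); rewrite !mem_core_beads; lia.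
have bd i : (i < b) = (i < d).
  by have := M (3 * i + 2); rewrite !mem_core_beads; lia.
have := ac a; have := ac c; have := bd b; have := bd d; rewrite !ltnn => *.
by congr pair; lia.
Qed.

Lemma core_of_three_core a b : three_core (core_of (a, b)).
Proof.
apply/three_core_closed3; first by rewrite unbeta_sorted ?core_beads_sorted.
by rewrite beta_core_of => z; rewrite !mem_core_beads; lia.
Qed.

(** [sumn_beta] with [a + b] beads and [sumn_core_beads] give the size [a^2 - a b + b^2 + b]; the
    hypothesis carries [a b] across to avoid truncated subtraction. *)
Lemma core_of_partition a b m : a * a + b * b + b = m + a * b ->
  is_partition m (core_of (a, b)).
Proof.
move=> E; rewrite /is_partition unbeta_sorted ?core_beads_sorted //.
rewrite unbeta_gt0 ?core_beads_sorted ?core_beads_gt0 //=.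
have := sumn_beta (core_of (a, b)); rewrite beta_core_of size_unbeta size_core_beads /=.
have := sumn_core_beads a b; move: (sumn _) (sumn _) => S T; nia.
Qed.

(** Closure makes the gaps of a runner closed upwards, and [a] is the first one. *)
Lemma closed3_runner B r : closed3 B -> exists a, forall i, (3 * i + r \in B) = (i < a).
Proof.
move=> cl; have ex : exists i, 3 * i + r \notin B.
  (* This position exceeds the sum of [B], hence every element of it. *)
  exists (sumn B).+1; apply/negP => /(nthP 0)[k kB kE].
  suff : 3 * (sumn B).+1 + r <= sumn B by lia.
  by rewrite -kE sumnE (big_nth 0) big_mkord (bigD1 (Ordinal kB)) //= leq_addr.
case: (ex_minnP ex) => a aB amin; exists a => i; case: ltnP => ia.
  by apply/negPn/negP => /amin; rewrite leqNgt ia.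
apply/negbTE; rewrite -(subnKC ia); elim: (i - a) => [|k IH]; first by rewrite addn0.
apply: contra IH => /cl; rewrite (_ : _ - 3 = 3 * (a + k) + r); last lia.
by apply; lia.
Qed.

Lemma three_core_core_of la m : is_partition m la -> three_core la ->
  exists a b, a * a + b * b + b = m + a * b /\ la = core_of (a, b).
Proof.
move=> /and3P[ss la0 /eqP sm] /(three_core_closed3 _ ss) cl.
have [a aE] := closed3_runner _ 1 cl; have [b bE] := closed3_runner _ 2 cl.
have [c cE] := closed3_runner _ 0 cl.
(* Runner 0 is empty, since 0 is not the first-column hook length of a positive part. *)
have c0 : c = 0.
  by apply/eqP; rewrite -leqn0 leqNgt -(cE 0) muln0 beta_gt0.
have bE' : beta la = core_beads a b.
  apply: (irr_sorted_eq gtn_trans); [exact: ltnn | exact: beta_sorted | exact: core_beads_sorted|].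
  move=> z; rewrite mem_core_beads.
  have [k [zE|[zE|zE]]] : exists k, z = 3 * k + 0 \/ z = 3 * k + 1 \/ z = 3 * k + 2.
    by exists (z %/ 3); lia.
  - by rewrite zE cE c0; lia.
  - by rewrite zE aE; lia.
  - by rewrite zE bE; lia.
have laE : la = core_of (a, b) by rewrite /core_of -bE' betaK.
exists a, b; split=> //.
have := sumn_beta la; rewrite bE' -(size_beta la) bE' size_core_beads sm.
have := sumn_core_beads a b; nia.
Qed.

(** Positive parts with sum [m] are at most [m] in number, and each is at most [m]. *)
Lemma mem_partitions_of m la : (la \in partitions_of m) = is_partition m la.
Proof.
rewrite mem_undup mem_filter andb_idr // => /and3P[_ la0 /eqP sm].
apply/flattenP; exists [seq map val (tval t) | t : (size la).-tuple 'I_m.+1].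
  apply/mapP; exists (size la) => //; rewrite mem_iota add0n ltnS -sm.
  by elim: la la0 {sm} => //= x s IH /andP[x0 /IH]; lia.
apply/imageP; exists (map_tuple inord (in_tuple la)) => //=.
rewrite -map_comp -[LHS]map_id; apply/eq_in_map => x xla /=.
rewrite inordK // ltnS -sm; elim: la xla {la0 sm} => //= y s IH.
by rewrite inE => /orP[/eqP -> | /IH]; lia.
Qed.

Definition core_pairs (m : nat) : seq (nat * nat) :=
  [seq ab <- [seq (a, b) | a <- iota 0 m.*2.+1, b <- iota 0 m.*2.+1]
   | ab.1 * ab.1 + ab.2 * ab.2 + ab.2 == m + ab.1 * ab.2].

Lemma mem_core_pairs m a b :
  ((a, b) \in core_pairs m) = (a * a + b * b + b == m + a * b).
Proof.
rewrite mem_filter andb_idr // => /eqP E; apply/allpairsP; exists (a, b).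
by rewrite /= in E; split=> //; rewrite mem_iota /=; nia.
Qed.

Lemma core_pairs_uniq m : uniq (core_pairs m).
Proof. by rewrite filter_uniq // allpairs_uniq ?iota_uniq // => -[a b] [c d]. Qed.

Lemma c3E m : c3 m = size (core_pairs m).
Proof.
rewrite /c3 -size_filter -(size_map core_of); apply/perm_size/uniq_perm.
- by rewrite filter_uniq // undup_uniq.
- by rewrite map_inj_uniq ?core_pairs_uniq //; apply: core_of_inj.
move=> la; rewrite mem_filter mem_partitions_of; apply/andP/mapP => [[tc pa]|].
  have [a [b [E ->]]] := three_core_core_of la m pa tc.
  by exists (a, b); rewrite ?mem_core_pairs ?E.
by move=> [[a b]]; rewrite mem_core_pairs => /eqP /core_of_partition pa ->;
  rewrite core_of_three_core.
Qed.

(** * The convolution of 3-core counts *)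

(** [x - y] is the residue of [x - w y] modulo [1 - w]; the condition picks one of each pair of
    opposites of norm prime to 3. *)
Definition residue_one (z : int * int) : bool := (3 %| (z.1 - z.2 - 1)%R)%Z.

(** Put [t = - x - y]. Under [residue_one] the differences [x - y], [y - t], [t - x] are all 1 mod
    3, hence nonzero, and sum to 0, so in cyclic order a positive one is followed by a negative one
    exactly once. This selects one point of each orbit of [rotate]. *)
Definition sector (z : int * int) : bool :=
  residue_one z && ((0 < z.1 - z.2) && (z.1 + 2 * z.2 < 0))%R.

(** Multiplication of [x - w y] by [w]. *)
Definition rotate (z : int * int) : int * int := (z.2, - z.1 - z.2)%R.

Lemma eis_rotate z : eis (rotate z).1 (rotate z).2 = eis z.1 z.2.
Proof. by rewrite /eis /=; ring. Qed.

Lemma rotate3 z : rotate (rotate (rotate z)) = z.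
Proof. by case: z => x y; rewrite /rotate /=; congr pair; lia. Qed.

Lemma residue_one_rotate z : residue_one (rotate z) = residue_one z.
Proof. by rewrite /residue_one /rotate /=; lia. Qed.

Lemma count_reps_rotate n (P : pred (int * int)) :
  count (fun z => P (rotate z)) (reps n) = count P (reps n).
Proof.
apply: (@count_reps_bij n n _ _ rotate (fun z => rotate (rotate z))) => x y E Pz.
  by rewrite eis_rotate rotate3.
by rewrite !eis_rotate rotate3.
Qed.

(* The six units act simply transitively on the six classes prime to [3]
   mod [3], and the rotations of order [3] fix the residue of [x - y]. *)
Lemma size_reps_sector n : n %% 3 = 1 ->
  size (reps n) = 6 * count sector (reps n).
Proof.
move=> n3.
have E2 : size (reps n) = 2 * count residue_one (reps n).
  rewrite -count_predT (count_split _ _ residue_one) mul2n -addnn; congr (_ + _).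
  apply: (@count_reps_bij _ _ _ _ (fun z => (- z.1, - z.2)%R) (fun z => (- z.1, - z.2)%R))
    => x y E /=; rewrite /residue_one /= => H.
    split; [by rewrite -E /eis; ring | | by rewrite !opprK].
    (* The remaining case [x = y] mod 3 would make the norm divisible by 3. *)
    have [k xk] : exists k : int, (x - y = 3 * k \/ x - y = 3 * k + 2)%R.
      by exists ((x - y)%R %/ 3)%Z; lia.
    case: xk => xk; last by lia.
    have : ((n%:Z - 3 * (3 * k * k + 3 * k * y + y * y)) = 0)%R.
      by rewrite -E /eis (_ : x = 3 * k + y)%R; [ring | lia].
    by move: (3 * k * k + _ + _)%R => c; lia.
  split; [by rewrite -E /eis; ring | lia | by rewrite !opprK].
rewrite E2; suff -> : count residue_one (reps n) = 3 * count sector (reps n) by lia.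
have rot1 := count_reps_rotate n sector.
have := count_reps_rotate n (fun z => sector (rotate z)); rewrite rot1 => rot2.
rewrite [LHS](count_split _ _ sector) !mulSn addn0; congr (_ + _).
  by apply: eq_count => z; rewrite /sector; case: residue_one.
rewrite [LHS](count_split _ _ (fun z => sector (rotate z))); congr (_ + _).
  rewrite -[RHS]rot1; apply: eq_count => -[x y].
  by rewrite /sector !residue_one_rotate /residue_one /rotate /=; lia.
rewrite -[RHS]rot2; apply: eq_count => -[x y].
by rewrite /sector !residue_one_rotate /residue_one /rotate /=; lia.
Qed.

(** In the sector [x - y = 3 a + 1] and [- x - 2 y = 3 b + 2] with natural [a] and [b], and the norm
    becomes [3 (a^2 - a b + b^2 + b) + 1]. *)
Lemma count_sector m : count sector (reps (3 * m + 1)) = size (core_pairs m).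
Proof.
rewrite -(count_predT (core_pairs m)).
apply: (@count_bij _ _ _ _ _ _
  (fun z => (`|((z.1 - z.2) %/ 3)%Z|%N, `|((- z.1 - 2 * z.2) %/ 3)%Z|%N))
  (fun ab => (2 * Posz ab.1 - Posz ab.2, - (Posz ab.1 + Posz ab.2 + 1))%R)).
- exact: reps_uniq.
- exact: core_pairs_uniq.
- move=> [x y]; rewrite mem_reps /sector /residue_one /= => /eqP E H.
  have [a aE] : exists a : nat, (x - y = 3 * a%:Z + 1)%R.
    by exists `|((x - y)%R %/ 3)%Z|%N; lia.
  have [b bE] : exists b : nat, (- x - 2 * y = 3 * b%:Z + 2)%R.
    by exists `|((- x - 2 * y)%R %/ 3)%Z|%N; lia.
  have -> : `|((x - y)%R %/ 3)%Z|%N = a by lia.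
  have -> : `|((- x - 2 * y)%R %/ 3)%Z|%N = b by lia.
  have xE : (x = 2 * a%:Z - b%:Z)%R by lia.
  have yE : (y = - (a%:Z + b%:Z + 1))%R by lia.
  split=> //; last by rewrite xE yE.
  by rewrite mem_core_pairs; move: E; rewrite xE yE /eis; lia.
move=> [a b]; rewrite mem_core_pairs => /eqP E _.
rewrite mem_reps /sector /residue_one /=; split; [rewrite /eis; lia | lia |].
by congr pair; lia.
Qed.

Lemma chi3_sum_c3 m : chi3_sum (3 * m + 1) = (c3 m)%:Z%R.
Proof.
have : ((size (reps (3 * m + 1)))%:Z = 6 * chi3_sum (3 * m + 1))%R by apply: size_reps; lia.
by rewrite size_reps_sector ?count_sector ?c3E; lia.
Qed.

Lemma sum_nat_mod3 n (F : nat -> int) :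
  (forall k, k < 3 * n + 2 -> k %% 3 != 1 -> F k = 0%R) ->
  (\sum_(1 <= k < 3 * n + 2) F k = \sum_(k < n.+1) F (3 * k + 1)%N)%R.
Proof.
elim: n => [|n IH] F0; first by rewrite big_nat1 big_ord1.
have -> : 3 * n.+1 + 2 = (3 * n + 2).+3 by lia.
rewrite !big_nat_recr; try lia; rewrite /= IH => [|k kn]; last by apply: F0; lia.
rewrite [RHS]big_ord_recr /=.
rewrite (F0 (3 * n + 2)%N) ?(F0 (3 * n + 2).+1) ?addr0; try lia.
by congr (_ + F _)%R; lia.
Qed.

(* For [k != 1 mod 3] one of [k] and [3 n + 2 - k] is [2 mod 3], where
   [chi3_sum] vanishes. *)
Lemma A3_sigma n : 3 * A3 n = sigma (3 * n + 2).
Proof.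
suff : (3 * (A3 n)%:Z = (sigma (3 * n + 2))%:Z)%R by lia.
rewrite -sum_chi3_sum; last by lia.
congr (_ * _)%R; rewrite sum_nat_mod3 => [|k kn k3].
  rewrite /A3 (big_morph Posz PoszD erefl); apply: eq_bigr => k _.
  rewrite PoszM -!chi3_sum_c3; congr (_ * chi3_sum _)%R.
  by have := ltn_ord k; lia.
case: (k %% 3 =P 2) => [k2 | k2]; first by rewrite (chi3_sum_eq0 k) ?mul0r.
by rewrite [chi3_sum (_ - k)]chi3_sum_eq0 ?mulr0 //; lia.
Qed.

Local Open Scope ring_scope.

Theorem theorem2p2 (n : nat) :
  ((A3 n)%:R = (sigma (3 * n + 2))%:R / 3 :> rat) /\
  ((A3 n)%:R = 3^-1 * \prod_(p <- primes (3 * n + 2))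
      (((p ^ (logn p (3 * n + 2)).+1)%:R - 1) / (p%:R - 1)) :> rat).
Proof.
have A3E : (A3 n)%:R = (sigma (3 * n + 2))%:R / 3 :> rat.
  by rewrite -A3_sigma natrM mulrAC divff ?mul1r.
by split=> //; rewrite A3E mulrC sigma_prod // addn2.
Qed.
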